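(* Let $(\Gamma,\mu)$ be a weighted graph satisfying $(p_0)$, $(VD)$ and $(TC)$, that is: (i) there is $p_0>0$ with $\mu_{x,y}/\mu(x)\ge p_0$ for all adjacent $x\sim y$; (ii) there is $D_V>0$ with $V(x,2R)\le D_V V(x,R)$ for all $x\in\Gamma$, $R>0$; (iii) there is $C_T>1$ with $E(x,2R)\le C_T\,E(y,R)$ for all $x\in\Gamma$, $R>0$, $y\in B(x,R)$. Then there is a constant $C>1$ such that for all $x\in\Gamma$ and all real $R\ge 1$, any two of the four quantities $$\lambda^{-1}(x,2R),\qquad E(x,2R),\qquad \overline{E}(x,2R),\qquad \rho(x,R,2R)\,v(x,R,2R)$$ are comparable with constant $C$, i.e. for any two of them, $a$ and $b$, we have $C^{-1}a\le b\le Ca$.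
   Context: $\Gamma$ is a countably infinite connected graph ($x\sim y$ denotes adjacency) with weights $\mu_{x,y}=\mu_{y,x}>0$ on its edges ($\mu_{x,y}=0$ if $x\not\sim y$); $\mu(x)=\sum_{y\sim x}\mu_{x,y}$ and $\mu(A)=\sum_{y\in A}\mu(y)$. $X_n$ is the random walk (reversible Markov chain) with transition probabilities $P(x,y)=\mu_{x,y}/\mu(x)$. $d$ is the shortest-path distance, $B(x,R)=\{y: d(x,y)<R\}$, $V(x,R)=\mu(B(x,R))$, and $v(x,r,R)=V(x,R)-V(x,r)$. For $A\subset\Gamma$, $T_A=\min\{k\ge 0: X_k\notin A\}$, $E_z(A)=\mathbb{E}(T_A\mid X_0=z)$, $E(x,R)=E_x(B(x,R))$, $\overline{E}(x,R)=\max_{z\in B(x,R)}E_z(B(x,R))$. The Laplacian is $\Delta=P-I$, i.e. $\Delta f(x)=\sum_y P(x,y)f(y)-f(x)$. For a finite set $A$, $\lambda(A)$ is the smallest eigenvalue of $-\Delta$ with Dirichlet boundary conditions on $A$ (the operator $f\mapsto -\Delta f$ restricted to $A$, acting on functions vanishing outside $A$), and $\lambda(x,R)=\lambda(B(x,R))$. With $(f,g)_\mu=\sum_x f(x)g(x)\mu(x)$, the resistance between disjoint sets $A,B$ is $\rho(A,B)=\left(\inf\{(-\Delta f,f)_\mu: f|_A=1,\ f|_B=0\}\right)^{-1}$, where $(-\Delta f,f)_\mu=\frac12\sum_{x,y}\mu_{x,y}(f(x)-f(y))^2$; and $\rho(x,r,R)=\rho(B(x,r),\Gamma\setminus B(x,R))$.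 *)

(* Defs.v *)
From HB Require Import structures.
From mathcomp Require Import all_boot all_order all_algebra.
From mathcomp Require Import all_classical all_reals all_analysis.

Set Implicit Arguments.
Unset Strict Implicit.
Unset Printing Implicit Defensive.

Import Order.TTheory GRing.Theory Num.Theory.
Local Open Scope classical_set_scope.
Local Open Scope ring_scope.

(* Local finiteness is not part of the structure: all that is required is that
   the total weight at a vertex be finite, so that P is a transition kernel. *)
Record weighted_graph (R : realType) (V : countType) := WeightedGraph {
  adj : rel V ;
  weight : V -> V -> R ;
  adj_sym : symmetric adj ;
  adj_connected : forall x y, exists2 p : seq V, path adj x p & last x p = y ;
  graph_infinite : infinite_set [set: V] ;
  weight_sym : forall x y, weight x y = weight y x ;
  weight_gt0 : forall x y, adj x y -> 0 < weight x y ;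
  weight_eq0 : forall x y, ~~ adj x y -> weight x y = 0 ;
  weight_summable :
    forall x, (\esum_(y in [set: V]) (weight x y)%:E < +oo)%E
}.

Section Graph.
Context {R : realType} {V : countType} (G : weighted_graph R V).

Definition vmeas (x : V) : R :=
  fine (\esum_(y in [set: V]) (weight G x y)%:E)%E.

Definition smeas (A : set V) : \bar R := (\esum_(y in A) (vmeas y)%:E)%E.

Definition trans (x y : V) : R := weight G x y / vmeas x.

Definition has_path_of_size (x y : V) (n : nat) : Prop :=
  exists p : seq V, [/\ path (adj G) x p, last x p = y & size p = n].

Lemma has_path_of_some_size (x y : V) :
  exists n, `[< has_path_of_size x y n >].
Proof.
have [p xp lp] := adj_connected G x y.
by exists (size p); apply/asboolP; exists p.
Qed.

Definition gdist (x y : V) : nat := ex_minn (has_path_of_some_size x y).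

Definition gball (x : V) (r : R) : set V := [set y | (gdist x y)%:R < r].

Definition vol (x : V) (r : R) : \bar R := smeas (gball x r).

Definition annvol (x : V) (r s : R) : \bar R := (vol x s - vol x r)%E.

(* The sum ranges over the y at which the summand is nonzero (and is 0 if there
   are infinitely many): this is the right value for finitely supported f. *)
Definition laplacian (f : V -> R) (x : V) : R :=
  (\sum_(y \in [set: V]) trans x y * f y) - f x.

Definition dirichlet_eigenvalue (A : set V) (t : R) : Prop :=
  exists f : V -> R,
    [/\ exists x, f x != 0,
        forall x, ~ A x -> f x = 0 &
        forall x, A x -> - laplacian f x = t * f x].

(* For A finite and nonempty the set of eigenvalues is finite and nonempty, so
   that this infimum is a minimum. *)
Definition dirichlet_lambda (A : set V) : R :=
  inf [set t | dirichlet_eigenvalue A t].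

Definition ball_lambda (x : V) (r : R) : R := dirichlet_lambda (gball x r).

Definition energy (f : V -> R) : \bar R :=
  ((2^-1)%:E * \esum_(p in [set: V * V])
                 (weight G p.1 p.2 * (f p.1 - f p.2) ^+ 2)%:E)%E.

(* [^-1] is here the inverse on the extended reals, with 0^-1 = +oo and
   +oo^-1 = 0. *)
Definition resistance (A B : set V) : \bar R :=
  (ereal_inf [set energy f | f in
      [set f : V -> R | (forall x, A x -> f x = 1%R) /\
                        (forall x, B x -> f x = 0%R)]])^-1%E.

Definition ann_resistance (x : V) (r s : R) : \bar R :=
  resistance (gball x r) (~` gball x s).

(* [Pr z] is the law of the walk started at z; the chain is specified by its
   finite-dimensional distributions. *)
Definition is_random_walk d (Om : measurableType d)
    (Pr : V -> probability Om R) (X : nat -> Om -> V) : Prop :=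
  (forall n x, measurable [set w | X n w = x]) /\
  (forall (z : V) (n : nat) (s : nat -> V),
     Pr z [set w | forall i, (i <= n)%N -> X i w = s i] =
     ((s 0%N == z)%:R * \prod_(i < n) trans (s i) (s i.+1))%:E).

Definition cond_p0 : Prop :=
  exists2 p0 : R, 0 < p0 & forall x y, adj G x y -> p0 <= trans x y.

Definition cond_VD : Prop :=
  exists2 DV : R, 0 < DV &
    forall (x : V) (r : R), 0 < r -> (vol x (2 * r) <= DV%:E * vol x r)%E.

End Graph.

Section ExitTime.
Context {R : realType} {V : countType} (G : weighted_graph R V).
Context {d : measure_display} {Om : measurableType d}.
Context (Pr : V -> probability Om R) (X : nat -> Om -> V).

(* Equal to +oo on the trajectories that never leave A. *)
Definition exit_time (A : set V) (w : Om) : \bar R :=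
  ereal_inf [set (k%:R)%:E | k in [set k : nat | ~ A (X k w)]].

Definition mean_exit (z : V) (A : set V) : \bar R :=
  (\int[Pr z]_w exit_time A w)%E.

Definition ball_exit (x : V) (r : R) : \bar R := mean_exit x (gball G x r).

Definition ball_max_exit (x : V) (r : R) : \bar R :=
  ereal_sup [set mean_exit z (gball G x r) | z in gball G x r].

Definition cond_TC : Prop :=
  exists2 CT : R, 1 < CT &
    forall (x y : V) (r : R), 0 < r -> gball G x r y ->
      (ball_exit x (2 * r) <= CT%:E * ball_exit y r)%E.

(* The inverse of the eigenvalue is taken in the reals, hence is finite;
   comparability with it entails finiteness of the other three quantities. *)
Definition four_quantities (x : V) (r : R) : seq (\bar R) :=
  [:: ((ball_lambda G x (2 * r))^-1)%:E;
      ball_exit x (2 * r);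
      ball_max_exit x (2 * r);
      (ann_resistance G x r (2 * r) * annvol G x r (2 * r))%E].

End ExitTime.

(* Main.v *)
Require Import Defs.
From HB Require Import structures.
From mathcomp Require Import all_boot all_order all_algebra.
From mathcomp Require Import all_classical all_reals all_analysis.
From mathcomp Require Import finmap measurable_realfun ring lra.

(* Write B = B(x,2R), E = E(x,2R), and M for the maximal mean exit time from B.
   The mean exit time w of a finite set A solves -Delta w = 1 on A, w = 0 off A,
   and the maximum principle makes it increasing in A. The four quantities are
   compared cyclically:
   - 1/lambda <= M: an eigenfunction f for t satisfies |f| <= t max|f| w;
   - M <= C_T E: for z in B, the set B is contained in B(z,4R), and (TC) applies
     as x is in B(z,2R);
   - E <= C_T^9 rho v: let u be the mean exit time of the annulus and k an
     integer between R and 2R (near 3R/2). On the sphere of radius k, (TC) gives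
     u >= c := E / C_T^4, so that min(1, u/c) extended by 1 to the ball of
     radius k is a test function for rho(x,R,2R); its energy is at most
     c^-2 (-Delta u, u) <= c^-2 C_T E v;
   - rho v <= D_V / lambda: every test function f has
     (-Delta f, f) >= lambda (f, f) >= lambda V(x,R), and (VD) applies. *)

Set Implicit Arguments.
Unset Strict Implicit.
Unset Printing Implicit Defensive.

Import Order.TTheory GRing.Theory Num.Theory.
Import numFieldNormedType.Exports.
Local Open Scope classical_set_scope.
Local Open Scope ring_scope.

(** * Finite quadratic forms *)

(** The determinant alternative for a square matrix, transported to indices in [A]. It serves to
    solve the Dirichlet problem and to show that an infimum of Rayleigh quotients is an
    eigenvalue. *)
Lemma kernel_or_inverse (F : fieldType) (T : choiceType) (A : {fset T})
    (M : T -> T -> F) :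
  (exists f : T -> F,
     [/\ exists x, f x != 0,
         forall x, x \notin A -> f x = 0 &
         forall x, x \in A -> \sum_(y <- A) M x y * f y = 0]) \/
  (exists W : T -> T -> F, forall x z, x \in A -> z \in A ->
     \sum_(y <- A) M x y * W y z = (x == z)%:R).
Proof.
pose n := #|{: A}|; pose e (i : 'I_n) : T := val (enum_val i : A).
pose rk (x : T) : option 'I_n := omap (fun a : A => enum_rank a) (insub x).
have eA i : e i \in A by exact: valP.
have rkE i : rk (e i) = Some i by rewrite /rk /e valK /= enum_valK.
have eP x : x \in A -> exists i, x = e i.
  by move=> xA; exists (enum_rank [` xA]%fset); rewrite /e enum_rankK.
have sumE (G : T -> F) : \sum_(y <- A) G y = \sum_(i < n) G (e i).
  by rewrite big_seq_fsetE /= big_enum_val.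
pose m : 'M[F]_n := \matrix_(i, j) M (e i) (e j).
(* [det0P] yields a left kernel vector, whence the transpose. *)
have [/det0P[v v0 vm]|dm] := boolP (\det m^T == 0); [left|right].
  exists (fun x => if rk x is Some i then v 0 i else 0); split.
  - have /rV0Pn[i vi] := v0.
    by exists (e i); rewrite rkE.
  - by move=> x xA; rewrite /rk insubN.
  - move=> _ /eP[i ->]; rewrite sumE.
    have /rowP/(_ i) := vm; rewrite !mxE => vmi; apply: etrans vmi.
    by apply: eq_bigr => j _; rewrite rkE !mxE mulrC.
have um : m \in unitmx by rewrite unitmxE unitfE -det_tr.
exists (fun x z => if (rk x, rk z) is (Some i, Some j)
                   then invmx m i j else 0).
move=> _ _ /eP[i ->] /eP[k ->]; rewrite sumE.
have /matrixP/(_ i k) := mulmxV um; rewrite !mxE.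
have -> : (e i == e k) = (i == k).
  by apply/eqP/eqP => [/(congr1 rk)|->//]; rewrite !rkE => -[].
by move=> mi; apply: etrans mi; apply: eq_bigr => j _; rewrite !rkE !mxE.
Qed.

(* If t := inf q/n were not an eigenvalue, then N := S - t m would be invertible.
   As N is positive semidefinite, evaluating its form at v - c N^-1 v with c
   small bounds it below by a multiple of |v|^2, so that q/n - t would be
   bounded away from 0. *)
Lemma rayleigh_le (R : realType) (T : choiceType) (A : {fset T})
    (S : T -> T -> R) (m : T -> R) :
  (forall x y, S x y = S y x) -> (forall x, x \in A -> 0 < m x) ->
  (forall f : T -> R, 0 <= \sum_(x <- A) f x * (\sum_(y <- A) S x y * f y)) ->
  forall h : T -> R, 0 < \sum_(x <- A) m x * h x ^+ 2 ->
  exists (t : R) (f : T -> R),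
    [/\ exists x, f x != 0,
        forall x, x \notin A -> f x = 0,
        forall x, x \in A -> \sum_(y <- A) S x y * f y = t * (m x * f x) &
        t * (\sum_(x <- A) m x * h x ^+ 2) <=
        \sum_(x <- A) h x * (\sum_(y <- A) S x y * h y)].
Proof.
move=> Ssym m0 S0 h h0.
pose n (f : T -> R) := \sum_(x <- A) m x * f x ^+ 2.
pose q (f : T -> R) := \sum_(x <- A) f x * (\sum_(y <- A) S x y * f y).
pose Q := [set q f / n f | f in [set f | 0 < n f]].
have Q0 : lbound Q 0.
  by move=> _ [f /= nf <-]; rewrite divr_ge0 ?S0 // ltW.
have hQ : has_inf Q by split; [exists (q h / n h), h | exists 0].
pose t := inf Q.
have tle f : 0 < n f -> t * n f <= q f.
  move=> nf; rewrite -ler_pdivlMr //; apply: ge_inf; first by exists 0.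
  by exists f.
pose N x y := S x y - t * (m x * (x == y)%:R).
have Nsym x y : N x y = N y x.
  by rewrite /N Ssym eq_sym; case: eqP => [->|]; rewrite ?mulr1 ?mulr0.
pose L f x := \sum_(y <- A) N x y * f y.
have LE f x : x \in A -> L f x = \sum_(y <- A) S x y * f y - t * (m x * f x).
  move=> xA; rewrite /L.
  under eq_bigr do rewrite mulrBl.
  rewrite sumrB; congr (_ - _).
  rewrite (bigD1_seq x) ?fset_uniq //= eqxx mulr1 big1 ?addr0 ?mulrA //.
  by move=> y yx; rewrite eq_sym (negbTE yx) !mulr0 mul0r.
have NE f : \sum_(x <- A) f x * L f x = q f - t * n f.
  rewrite /q /n mulr_sumr -sumrB; apply: eq_big_seq => x xA.
  by rewrite LE //; ring.
have [[f [f0 fA fN]]|[W WE]] := kernel_or_inverse A N.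
  exists t, f; split=> //; last exact: tle.
  by move=> x xA; apply/eqP; rewrite -subr_eq0 -LE //; exact/eqP/fN.
exfalso.
(* [K] will bound the form of [W], and [Mm] the weights [m]; the added 1 makes both positive. *)
pose K := 1 + \sum_(x <- A) \sum_(z <- A) `|W x z|.
have K0 : 0 < K by rewrite ltr_pwDl // sumr_ge0 // => x _; rewrite sumr_ge0.
pose Mm := 1 + \sum_(x <- A) m x.
have m0' : 0 <= \sum_(x <- A) m x.
  by rewrite big_seq sumr_ge0 // => x xA; rewrite ltW // m0.
have Mm0 : 0 < Mm by rewrite ltr_pwDl.
have n0 f : 0 <= n f.
  rewrite /n big_seq sumr_ge0 // => x xA.
  by rewrite mulr_ge0 ?sqr_ge0 // ltW // m0.
have Npos f : 0 <= q f - t * n f.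
  rewrite subr_ge0; have := n0 f; rewrite le_eqVlt => /orP[/eqP <-|/tle//].
  by rewrite mulr0 S0.
pose s (v : T -> R) := \sum_(x <- A) v x ^+ 2.
have sle (v : T -> R) x : x \in A -> v x ^+ 2 <= s v.
  move=> xA; rewrite /s (bigD1_seq x) ?fset_uniq //= lerDl.
  by rewrite sumr_ge0 // => y _; rewrite sqr_ge0.
have gap v : s v <= K * (q v - t * n v).
  pose w x := \sum_(z <- A) W x z * v z.
  have Lw x : x \in A -> L w x = v x.
    move=> xA; rewrite /L /w.
    under eq_bigr do rewrite mulr_sumr.
    rewrite exchange_big /=.
    rewrite (eq_big_seq (fun z => (x == z)%:R * v z)); last first.
      move=> z zA; rewrite -(WE x z xA zA) mulr_suml.
      by apply: eq_bigr => y _; rewrite mulrA.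
    rewrite (bigD1_seq x) ?fset_uniq //= eqxx mul1r big1 ?addr0 //.
    by move=> z zx; rewrite eq_sym (negbTE zx) mul0r.
  have vw : \sum_(x <- A) v x * w x <= K * s v.
    apply: (@le_trans _ _ (\sum_(x <- A) \sum_(z <- A) `|W x z| * s v)).
      rewrite big_seq [leRHS]big_seq; apply: ler_sum => x xA.
      rewrite /w mulr_sumr big_seq [leRHS]big_seq; apply: ler_sum => z zA.
      rewrite mulrCA (le_trans (ler_norm _)) // normrM ler_wpM2l //.
      rewrite normrM.
      have := sle v x xA; have := sle v z zA.
      rewrite -[v x ^+ 2]real_normK ?num_real //.
      rewrite -[v z ^+ 2]real_normK ?num_real //.
      have := sqr_ge0 (`|v x| - `|v z|); rewrite !expr2; nra.
    rewrite /K mulrDl mul1r mulr_suml.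
    under [X in _ <= _ + X]eq_bigr do rewrite mulr_suml.
    by rewrite lerDr sumr_ge0 // => x _; rewrite sqr_ge0.
  have wLv : \sum_(x <- A) w x * L v x = s v.
    rewrite /L; under eq_bigr do rewrite mulr_sumr.
    rewrite exchange_big /=; apply: eq_big_seq => y yA.
    rewrite expr2 -[X in _ = _ * X](Lw y yA) /L mulr_sumr.
    by apply: eq_bigr => x _; rewrite (Nsym x y); ring.
  (* With this [c] the quadratic term is at most [c * s v]; it is absorbed by one of the two linear
     terms [- c * s v], leaving [c * s v <= q v - t * n v]. *)
  pose c := K^-1.
  have := Npos (fun x => v x - c * w x); rewrite -NE.
  have -> : \sum_(x <- A) (v x - c * w x) * L (fun x => v x - c * w x) x =
      (q v - t * n v) - c * s v - c * s v + c ^+ 2 * \sum_(x <- A) v x * w x.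
    rewrite -NE -[X in _ - c * X - _]wLv /s !mulr_sumr -!sumrB -big_split /=.
    apply: eq_big_seq => x xA.
    have -> : L (fun x => v x - c * w x) x = L v x - c * v x.
      rewrite -(Lw x xA) /L mulr_sumr -sumrB; apply: eq_bigr => y _; ring.
    ring.
  move=> H.
  have : c ^+ 2 * \sum_(x <- A) v x * w x <= c ^+ 2 * (K * s v).
    by rewrite ler_wpM2l // sqr_ge0.
  have -> : c ^+ 2 * (K * s v) = c * s v.
    by rewrite /c expr2 -mulrA mulKf // gt_eqF.
  move=> H2; have : c * s v <= q v - t * n v by lra.
  by rewrite /c ler_pdivrMl.
(* By [gap], [n f <= Mm * s f <= Mm * K * (q f - t * n f)]: every quotient exceeds the infimum [t]
   by at least [(K * Mm)^-1], which is absurd. *)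
have : t + (K * Mm)^-1 <= t.
  apply: lb_le_inf; first by case: hQ.
  move=> _ [f /= nf <-]; rewrite ler_pdivlMr // mulrDl -lerBrDl.
  rewrite ler_pdivrMl ?mulr_gt0 // mulrAC.
  apply: (@le_trans _ _ (Mm * s f)).
    rewrite /Mm mulrDl mul1r mulr_suml -[n f]add0r lerD //.
      by rewrite sumr_ge0 // => x _; rewrite sqr_ge0.
    rewrite /n big_seq [leRHS]big_seq; apply: ler_sum => x xA.
    by rewrite ler_wpM2l ?sle // ltW // m0.
  by rewrite mulrC ler_wpM2r ?gap // ltW.
by rewrite gerDl leNgt invr_gt0 mulr_gt0.
Qed.

(** * Balls, neighbours and the maximum principle *)

Lemma esum_support (R : realType) (T : choiceType) (B : {fset T}) (D : set T)
    (a : T -> \bar R) :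
  (forall x, D x -> (0 <= a x)%E) -> [set` B] `<=` D ->
  (forall x, D x -> x \notin B -> a x = 0%E) ->
  (\esum_(x in D) a x = \sum_(x <- B) a x)%E.
Proof.
move=> a0 BD aB; rewrite (esumID [set` B]) //.
rewrite [X in (_ + X)%E]esum1 ?adde0; last first.
  by move=> x [Dx /negP xB]; exact: aB.
rewrite (setIidr BD) esum_fset //; last by move=> x /set_mem /BD /a0.
by rewrite -fsbig_seq ?fset_uniq.
Qed.

Lemma fset_argmax (R : realDomainType) (T : choiceType) (A : {fset T})
    (g : T -> R) (x : T) :
  x \in A -> exists2 y, y \in A & forall z, z \in A -> g z <= g y.
Proof.
move=> xA.
have [i _ iP] := @arg_maxP _ _ A [` xA]%fset xpredT (fun a => g (val a)) isT.
exists (val i) => [|z zA]; first exact: valP.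
exact: (iP [` zA]%fset isT).
Qed.

Section GraphBasics.
Context {R : realType} {V : countType} (G : weighted_graph R V).

Lemma weight_ge0 x y : 0 <= weight G x y.
Proof.
by have [/(weight_gt0 (w:=G))/ltW|/weight_eq0->] := boolP (adj G x y).
Qed.

(** As the graph is infinite, some vertex lies outside [A]; a path from [x] to it has a first edge
    leaving [A]. This gives positive measures, the strict inequality in the maximum principle, and
    nonempty annuli. *)
Lemma exit_edge (A : {fset V}) x : x \in A ->
  exists y z, [/\ y \in A, z \notin A & adj G y z].
Proof.
move=> xA.
have [z zA] : exists z, z \notin A.
  apply/not_existsP => zA; apply: (graph_infinite G).
  apply: (@sub_finite_set _ _ [set` A]) => //= z _.
  by apply/negPn/negP; exact: zA.
have [p] := adj_connected G x z; elim: p x xA => [|y p IH] x xA /=.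
  by move=> _ xz; rewrite -xz xA in zA.
case/andP=> xy yp yz.
have [yA|yA] := boolP (y \in A); first exact: IH yA yp yz.
by exists x, y.
Qed.

Lemma gdist_path x y :
  exists p : seq V, [/\ path (adj G) x p, last x p = y & size p = gdist G x y].
Proof. by rewrite /gdist; case: ex_minnP => n /asboolP. Qed.

Lemma gdist_le x p : path (adj G) x p -> (gdist G x (last x p) <= size p)%N.
Proof.
move=> xp; rewrite /gdist; case: ex_minnP => n _; apply.
by apply/asboolP; exists p.
Qed.

Lemma gdistxx x : gdist G x x = 0%N.
Proof. by apply/eqP; rewrite -leqn0; exact: (@gdist_le x [::]). Qed.

Lemma gdist_triangle x y z : (gdist G x z <= gdist G x y + gdist G y z)%N.
Proof.
have [p [xp lp <-]] := gdist_path x y; have [q [yq lq <-]] := gdist_path y z.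
rewrite -size_cat -lq -lp -last_cat; apply: gdist_le.
by rewrite cat_path xp lp.
Qed.

Lemma gdistC x y : gdist G x y = gdist G y x.
Proof.
suff le a b : (gdist G b a <= gdist G a b)%N by apply/eqP; rewrite eqn_leq !le.
have [p [ap lp <-]] := gdist_path a b.
have rp : path (adj G) b (rev (belast a p)).
  rewrite -lp rev_path; apply: sub_path ap => u v /=.
  by rewrite (adj_sym G).
have := gdist_le rp; rewrite size_rev size_belast.
suff -> : last b (rev (belast a p)) = a by [].
by case: p lp {ap rp} => [<-|c p _] //=; rewrite rev_cons last_rcons.
Qed.

Lemma gdist_adj y z : adj G y z -> (gdist G y z <= 1)%N.
Proof. by move=> yz; apply: (@gdist_le y [:: z]); rewrite /= yz. Qed.

Lemma gball_center x (r : R) : 0 < r -> gball G x r x.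
Proof. by rewrite /gball /= gdistxx. Qed.

Lemma gball_sym x y (r : R) : gball G x r y -> gball G y r x.
Proof. by rewrite /gball /= gdistC. Qed.

Lemma sub_gball x (r s : R) : r <= s -> gball G x r `<=` gball G x s.
Proof. by move=> rs y; rewrite /gball /= => /lt_le_trans; apply. Qed.

Lemma gball_sub x y (r s : R) : gball G x r y ->
  gball G y s `<=` gball G x (r + s).
Proof.
rewrite /gball /= => xy z /= yz.
apply: le_lt_trans (ltrD xy yz); rewrite -natrD ler_nat.
exact: gdist_triangle.
Qed.

Lemma vmeas_ge_sum x (B : {fset V}) : \sum_(y <- B) weight G x y <= vmeas G x.
Proof.
rewrite -lee_fin /vmeas fineK; last first.
  rewrite ge0_fin_numE ?weight_summable //.
  by apply: esum_ge0 => y _; rewrite lee_fin weight_ge0.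
rewrite -sumEFin; apply: esum_ge; exists [set` B] => //.
by rewrite -fsbig_seq ?fset_uniq.
Qed.

Lemma vmeas_gt0 x : 0 < vmeas G x.
Proof.
have [y [z []]] := exit_edge (fset11 x).
rewrite inE => /eqP -> _ /(weight_gt0 (w:=G)) xz.
by apply: lt_le_trans (vmeas_ge_sum x [fset z]%fset); rewrite big_seq_fset1.
Qed.

Lemma trans_ge0 x y : 0 <= trans G x y.
Proof. by rewrite divr_ge0 ?weight_ge0 // ltW // vmeas_gt0. Qed.

Lemma trans_eq0 x y : ~~ adj G x y -> trans G x y = 0.
Proof. by move=> /weight_eq0; rewrite /trans => ->; rewrite mul0r. Qed.

Lemma trans_gt0 x y : adj G x y -> 0 < trans G x y.
Proof. by move=> /(weight_gt0 (w:=G)) xy; rewrite divr_gt0 ?vmeas_gt0. Qed.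

Lemma vmeas_trans x y : vmeas G x * trans G x y = weight G x y.
Proof. by rewrite /trans mulrC divfK // gt_eqF // vmeas_gt0. Qed.

(** Removes the finite-support convention of [laplacian]: any finite set carrying the summand will
    do. *)
Lemma laplacianE f x (B : {fset V}) :
  (forall y, y \notin B -> trans G x y * f y = 0) ->
  laplacian G f x = \sum_(y <- B) trans G x y * f y - f x.
Proof. by move=> fB; rewrite /laplacian (@fsbigTE _ _ _ _ B). Qed.

End GraphBasics.

(** * Local finiteness from $(p_0)$, and the maximum principle *)

Section LocallyFinite.
Context {R : realType} {V : countType} (G : weighted_graph R V).
Hypothesis hp0 : cond_p0 G.

(** Each neighbour receives probability at least [p] out of a total of at most 1, so there cannot be
    more than [p^-1] of them. *)
Lemma neighbours_finite x : finite_set [set y | adj G x y].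
Proof.
case: hp0 => p p0 ptr; apply: contrapT => inf.
have [B BA cB] := infinite_set_fset (Num.truncn p^-1).+1 inf.
have : \sum_(y <- B) p <= 1.
  apply: (@le_trans _ _ (\sum_(y <- B) trans G x y)).
    by rewrite big_seq [leRHS]big_seq; apply: ler_sum => y yB; exact/ptr/BA.
  rewrite /trans -mulr_suml ler_pdivrMr ?vmeas_gt0 // mul1r.
  exact: vmeas_ge_sum.
rewrite big_const_seq count_predT iter_addr_0 -mulr_natl -ler_pdivlMr // mul1r.
rewrite leNgt => /negP; apply.
apply: lt_le_trans (_ : (Num.truncn p^-1).+1%:R <= _); last by rewrite ler_nat.
by rewrite truncnS_gt.
Qed.

Definition nbrs x : {fset V} := fset_set [set y | adj G x y].

Lemma in_nbrs x y : (y \in nbrs x) = adj G x y.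
Proof.
rewrite in_fset_set; last exact: neighbours_finite.
by apply/idP/idP => [/set_mem|xy]; [|exact: mem_set].
Qed.

Lemma vmeasE x : vmeas G x = \sum_(y <- nbrs x) weight G x y.
Proof.
rewrite /vmeas (esum_support (B:=nbrs x)) ?sumEFin //.
  by move=> y _; rewrite lee_fin weight_ge0.
by move=> y _; rewrite in_nbrs => /weight_eq0 ->.
Qed.

Lemma sum_trans x : \sum_(y <- nbrs x) trans G x y = 1.
Proof. by rewrite -mulr_suml -vmeasE divff // gt_eqF // vmeas_gt0. Qed.

Lemma laplacian_nbrs f x :
  laplacian G f x = \sum_(y <- nbrs x) trans G x y * f y - f x.
Proof.
by apply: laplacianE => y; rewrite in_nbrs => /trans_eq0 ->; rewrite mul0r.
Qed.

Lemma laplacianB f g (c : R) x :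
  laplacian G (fun y => f y - c * g y) x =
  laplacian G f x - c * laplacian G g x.
Proof.
rewrite !laplacian_nbrs.
under eq_bigr do rewrite mulrBr mulrCA.
by rewrite sumrB -mulr_sumr; ring.
Qed.

(** Induction on an integer radius: the last edge of a geodesic shows that the next ball is covered
    by [x] and the neighbours of the previous ball. *)
Lemma gball_finite x (r : R) : finite_set (gball G x r).
Proof.
have fin n : finite_set [set y | (gdist G x y <= n)%N].
  elim: n => [|n IH].
    apply: (@sub_finite_set _ _ [set x]) => [y /=|]; last exact: finite_set1.
    rewrite leqn0 => /eqP y0; have [p [_ lp]] := gdist_path G x y.
    by rewrite y0 => /size0nil p0; rewrite -lp p0.
  apply: (@sub_finite_set _ _ ([set x] `|` \bigcup_(z in
      [set z | (gdist G x z <= n)%N]) [set y | adj G z y])); last first.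
    rewrite finite_setU; split; first exact: finite_set1.
    by apply: bigcup_finite => // z _; exact: neighbours_finite.
  move=> y /=; have [p [xp <- <-]] := gdist_path G x y.
  case/lastP: p xp => [|p z]; first by left.
  rewrite rcons_path last_rcons size_rcons ltnS => /andP[xp pz] pn; right.
  by exists (last x p) => //=; apply: leq_trans pn; exact: gdist_le.
apply: sub_finite_set (fin (Num.truncn r)) => y /= yr.
rewrite -ltnS -(ltr_nat R); apply: lt_trans yr _.
by rewrite truncnS_gt.
Qed.

(** If the maximum over [A] were positive, it would be the global maximum. An edge [a], [b] leaving
    the set [A'] where it is attained would have [g b < g a], making the Laplacian negative at
    [a]. *)
Lemma maximum_principle (A : {fset V}) (g : V -> R) :
  (forall x, x \notin A -> g x <= 0) ->
  (forall x, x \in A -> 0 <= laplacian G g x) ->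
  forall x, g x <= 0.
Proof.
move=> gA subg x; have [xA|/gA//] := boolP (x \in A).
have [y yA yM] := fset_argmax g xA.
rewrite (le_trans (yM _ xA)) // leNgt; apply/negP => gy.
pose A' := [fset z in A | g z == g y]%fset.
have yA' : y \in A' by rewrite !inE yA eqxx.
have [a [b [+ bA ab]]] := exit_edge G yA'.
rewrite !inE => /andP[aA /eqP ga].
have gle z : g z <= g y.
  by have [/yM//|/gA/le_trans->//] := boolP (z \in A); exact: ltW.
have gb : g b < g y.
  rewrite lt_neqAle gle andbT; apply/eqP => gby; case/negP: bA.
  rewrite !inE gby eqxx andbT; apply: contraTT gy => /gA.
  by rewrite gby -leNgt.
have := subg a aA; rewrite laplacian_nbrs ga.
rewrite -[g y]mul1r -(sum_trans a) mulr_suml -sumrB leNgt => /negP; apply.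
rewrite (bigD1_seq b) ?fset_uniq ?in_nbrs //=.
rewrite -[ltRHS]addr0 ltr_leD //.
  by rewrite -mulrBr pmulr_rlt0 ?subr_lt0 // trans_gt0.
apply: sumr_le0 => z _.
by rewrite -mulrBr mulr_ge0_le0 ?subr_le0 // trans_ge0.
Qed.

End LocallyFinite.

(** * The Dirichlet problem, the first eigenvalue and the energy *)

Section Dirichlet.
Context {R : realType} {V : countType} (G : weighted_graph R V).
Hypothesis hp0 : cond_p0 G.
Implicit Types (A : {fset V}) (f g w : V -> R).

(** Puts the Dirichlet operator in the matrix form that [kernel_or_inverse] accepts. *)
Lemma dirichlet_sum A f x : (forall y, y \notin A -> f y = 0) -> x \in A ->
  \sum_(y <- A) ((x == y)%:R - trans G x y) * f y = - laplacian G f x.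
Proof.
move=> fA xA; rewrite (laplacianE (B:=A)); last first.
  by move=> y /fA ->; rewrite mulr0.
under eq_bigr do rewrite mulrBl.
rewrite sumrB opprB; congr (_ - _).
rewrite (bigD1_seq x) ?fset_uniq //= eqxx mul1r big1 ?addr0 //.
by move=> y yx; rewrite eq_sym (negbTE yx) mul0r.
Qed.

Definition poisson_solution A w :=
  (forall x, x \notin A -> w x = 0) /\
  (forall x, x \in A -> - laplacian G w x = 1).

(** A kernel vector is harmonic on [A] and vanishes outside, so the maximum principle for it and its
    opposite makes it zero. Hence the operator is invertible, and its inverse is applied to the
    constant 1. *)
Lemma poisson_exists A : exists w, poisson_solution A w.
Proof.
have [[f [[x fx] fA fM]]|[W WE]] :=
    kernel_or_inverse A (fun x y => (x == y)%:R - trans G x y).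
  have lf y : y \in A -> laplacian G f y = 0.
    by move=> yA; apply: oppr_inj; rewrite -(dirichlet_sum fA) ?fM ?oppr0.
  have f0 y : f y <= 0.
    apply: (maximum_principle hp0 (A:=A) (g:=f)) => z zA; first by rewrite fA.
    by rewrite lf.
  have f0' y : 0 - 1 * f y <= 0.
    apply: (maximum_principle hp0 (A:=A) (g:=fun y => 0 - 1 * f y)) => z zA.
      by rewrite fA // mulr0 subr0.
    rewrite (laplacianB hp0 (fun=> 0)) lf // mulr0 subr0 laplacian_nbrs //.
    by rewrite big1 ?subr0 // => u _; rewrite mulr0.
  case/negP: fx; rewrite eq_le f0 /=.
  by have := f0' x; rewrite mul1r sub0r oppr_le0.
pose w x := if x \in A then \sum_(z <- A) W x z else 0.
have wA x : x \notin A -> w x = 0 by rewrite /w => /negbTE ->.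
exists w; split=> // x xA; rewrite -(dirichlet_sum wA) //.
rewrite (eq_big_seq (fun y => \sum_(z <- A)
    ((x == y)%:R - trans G x y) * W y z)); last first.
  by move=> y yA; rewrite /w yA mulr_sumr.
rewrite exchange_big /= (eq_big_seq (fun z => (x == z)%:R)); last first.
  by move=> z zA; rewrite WE.
rewrite (bigD1_seq x) ?fset_uniq //= eqxx big1 ?addr0 //.
by move=> z zx; rewrite eq_sym (negbTE zx).
Qed.

Lemma poisson_ge0 A w x : poisson_solution A w -> 0 <= w x.
Proof.
move=> [wA wl].
have : 0 - 1 * w x <= 0.
  apply: (maximum_principle hp0 (A:=A) (g:=fun y => 0 - 1 * w y)) => z zA.
    by rewrite wA // mulr0 subr0.
  rewrite (laplacianB hp0 (fun=> 0)) mul1r wl // laplacian_nbrs // big1.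
    by rewrite subr0 add0r.
  by move=> u _; rewrite mulr0.
by rewrite mul1r sub0r oppr_le0.
Qed.

(** The difference [w - w'] is harmonic on [A], and outside [A] it is [- w' <= 0]. *)
Lemma poisson_le A B w w' x : (A `<=` B)%fset ->
  poisson_solution A w -> poisson_solution B w' -> w x <= w' x.
Proof.
move=> AB [wA wl] sw'; have [wB wl'] := sw'; rewrite -subr_le0 -[w' x]mul1r.
apply: (maximum_principle hp0 (A:=A) (g:=fun y => w y - 1 * w' y)) => z zA.
  by rewrite wA // sub0r mul1r oppr_le0 (poisson_ge0 _ sw').
rewrite laplacianB // mul1r -[laplacian G w z]opprK wl // wl' ?addNr //.
exact: (fsubsetP AB).
Qed.

(** On [A] one has [w = 1 + P w] with [w >= 0]: leaving takes at least one step. *)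
Lemma poisson_ge1 A w x : poisson_solution A w -> x \in A -> 1 <= w x.
Proof.
move=> sw xA; have [wA /(_ _ xA)] := sw; rewrite laplacian_nbrs // opprB => <-.
rewrite lerBlDr lerDl sumr_ge0 // => y _.
by rewrite mulr_ge0 ?trans_ge0 // (poisson_ge0 _ sw).
Qed.

(** Since [(1 - t) |f| <= P |f|] on [A], the function [|f| - t max|f| w] is subharmonic there, hence
    nonpositive everywhere; evaluate it where [|f|] is maximal. *)
Lemma eigenvalue_ge A w (M t : R) : poisson_solution A w ->
  (forall x, w x <= M) -> dirichlet_eigenvalue G [set` A] t -> 1 <= t * M.
Proof.
move=> sw wM [f [[x fx] fA0 ft]]; have [wA wl] := sw.
have fA y : y \notin A -> f y = 0 by move=> /negP; exact: fA0.
have xA : x \in A by apply: contraNT fx => /fA ->.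
have [y yA yM] := fset_argmax (fun z => `|f z|) xA.
have f0 : 0 < `|f y| by apply: lt_le_trans (yM _ xA); rewrite normr_gt0.
have fle z : `|f z| <= `|f y|.
  by have [/yM//|/fA->] := boolP (z \in A); rewrite normr0.
have fE z : z \in A -> \sum_(u <- nbrs G z) trans G z u * f u = (1 - t) * f z.
  move=> /ft; rewrite laplacian_nbrs // opprB => h.
  by rewrite mulrBl mul1r -h; ring.
have trle z : `|\sum_(u <- nbrs G z) trans G z u * f u| <=
    \sum_(u <- nbrs G z) trans G z u * `|f u|.
  rewrite (le_trans (ler_norm_sum _ _ _)) //; apply: ler_sum => u _.
  by rewrite normrM ger0_norm // trans_ge0.
(* [|1 - t| max |f| = |P f| <= max |f|] at a maximum of [|f|] *)
have t0 : 0 <= t.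
  have : `|1 - t| * `|f y| <= 1 * `|f y|.
    rewrite -normrM -fE // (le_trans (trle y)) //.
    rewrite -(sum_trans hp0 y) mulr_suml; apply: ler_sum => u _.
    by rewrite ler_wpM2l ?trans_ge0.
  by rewrite ler_pM2r // ler_norml => /andP[_]; lra.
have : `|f y| - t * `|f y| * w y <= 0.
  apply: (maximum_principle hp0 (A:=A)
           (g:=fun z => `|f z| - t * `|f y| * w z)) => z zA.
    by rewrite fA // wA // normr0 mulr0 subr0.
  rewrite laplacianB // -[laplacian G w z]opprK wl // mulrN1 opprK.
  rewrite laplacian_nbrs //.
  have h : (1 - t) * `|f z| <= `|(1 - t) * f z|.
    by rewrite normrM ler_wpM2r // ler_norm.
  have := trle z; rewrite fE // => /(le_trans h) h2.
  by have := ler_wpM2l t0 (fle z); lra.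
have := wM y => wy; rewrite subr_le0 => h.
have : `|f y| * 1 <= `|f y| * (t * M).
  rewrite mulr1 (le_trans h) // mulrAC mulrC ler_wpM2l // ler_wpM2l //.
by rewrite ler_pM2l.
Qed.

(** Discrete Green formula, which also shows that the energy is finite. *)
Lemma energyE A f : (forall x, x \notin A -> f x = 0) ->
  energy G f = (\sum_(x <- A) f x * (vmeas G x * - laplacian G f x))%:E.
Proof.
move=> fA.
(* [A] with its outer boundary: edges not contained in [B] carry no energy. *)
pose B := (A `|` [fset y | x in A, y in nbrs G x])%fset.
have AB x : x \in A -> x \in B by move=> xA; rewrite inE xA.
have nB x y : x \in A -> adj G x y -> y \in B.
  move=> xA xy; rewrite inE; apply/orP; right; apply/imfset2P.
  by exists x => //; exists y => //=; rewrite in_nbrs.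
have term0 x y : y \notin B -> weight G x y * (f x - f y) ^+ 2 = 0.
  move=> yB; have yA : y \notin A by apply: contra yB; exact: AB.
  have [xA|xA] := boolP (x \in A); last by rewrite !fA // subrr expr0n mulr0.
  rewrite weight_eq0 ?mul0r //; apply: contra yB; exact: nB.
rewrite /energy.
have -> : (\esum_(p in [set: V * V])
    (weight G p.1 p.2 * (f p.1 - f p.2) ^+ 2)%:E =
    (\sum_(x <- B) \sum_(y <- B) weight G x y * (f x - f y) ^+ 2)%:E)%E.
  have -> : [set: V * V] = [set: V] `*`` (fun=> [set: V]).
    by apply/seteqP; split=> -[].
  have t0 x y : 0 <= weight G x y * (f x - f y) ^+ 2.
    by rewrite mulr_ge0 ?weight_ge0 ?sqr_ge0.
  rewrite -(esum_esum (a:=fun x y => (weight G x y * (f x - f y) ^+ 2)%:E));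
    last by move=> x y _ _; rewrite lee_fin.
  rewrite (eq_esum (b:=fun x =>
      (\sum_(y <- B) weight G x y * (f x - f y) ^+ 2)%:E)); last first.
    move=> x _; rewrite (esum_support (B:=B)) ?sumEFin //.
      by move=> y _; rewrite lee_fin.
    by move=> y _ yB; rewrite term0.
  rewrite (esum_support (B:=B)) ?sumEFin //.
    by move=> x _; rewrite lee_fin sumr_ge0.
  move=> x _ xB; rewrite big1 // => y _.
  by rewrite weight_sym -sqrrN opprB term0.
rewrite -EFinM; congr (_%:E).
(* The summand equals [h x y + h y x]; exchanging the sums then cancels the factor 1/2. *)
pose h x y := f x * (weight G x y * (f x - f y)).
have -> : \sum_(x <- B) \sum_(y <- B) weight G x y * (f x - f y) ^+ 2 =
    \sum_(x <- B) \sum_(y <- B) h x y + \sum_(x <- B) \sum_(y <- B) h x y.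
  rewrite [X in _ + X]exchange_big /= -big_split; apply: eq_bigr => x _ /=.
  rewrite -big_split; apply: eq_bigr => y _ /=.
  by rewrite /h (weight_sym G y x); ring.
have half (z : R) : 2^-1 * (z + z) = z by lra.
rewrite half.
rewrite -(@big_fset_incl _ _ _ _ A B); last 2 first.
- by apply/fsubsetP => x; exact: AB.
- by move=> x _ xA; rewrite big1 // => y _; rewrite /h fA // mul0r.
apply: eq_big_seq => x xA; rewrite /h -mulr_sumr; congr (_ * _).
rewrite -(@big_fset_incl _ _ _ _ (nbrs G x) B); last 2 first.
- by apply/fsubsetP => y; rewrite in_nbrs //; exact: nB.
- by move=> y _; rewrite in_nbrs // => /weight_eq0 ->; rewrite mul0r.
rewrite laplacian_nbrs // opprB mulrBr {1}vmeasE // mulr_suml mulr_sumr -sumrB.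
by apply: eq_bigr => y _; rewrite mulrA vmeas_trans mulrBr.
Qed.

Lemma energy_ge0 f : (0 <= energy G f)%E.
Proof.
rewrite mule_ge0 // ?lee_fin ?invr_ge0 //; apply: esum_ge0 => p _.
by rewrite lee_fin mulr_ge0 ?weight_ge0 ?sqr_ge0.
Qed.

(** * The first Dirichlet eigenvalue: lower bound and variational inequality *)

Section Lambda.
Variables (A : {fset V}) (w : V -> R) (M : R).
Hypotheses (sw : poisson_solution A w) (wM : forall x, w x <= M).

Lemma poisson_bound_gt0 x : x \in A -> 0 < M.
Proof.
move=> xA; rewrite (lt_le_trans ltr01) // (le_trans _ (wM x)) //.
exact: poisson_ge1 xA.
Qed.

(** Reversibility: multiplied by [vmeas], the matrix of the Dirichlet operator becomes symmetric,
    and its form is the energy, so [rayleigh_le] applies. *)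
Lemma rayleigh_exists h : 0 < \sum_(x <- A) vmeas G x * h x ^+ 2 ->
  (forall x, x \notin A -> h x = 0) ->
  exists2 t, dirichlet_eigenvalue G [set` A] t &
    ((t * \sum_(x <- A) vmeas G x * h x ^+ 2)%:E <= energy G h)%E.
Proof.
move=> h0 hA.
pose S x y := vmeas G x * ((x == y)%:R - trans G x y).
have SE f x : (forall x, x \notin A -> f x = 0) -> x \in A ->
    \sum_(y <- A) S x y * f y = vmeas G x * - laplacian G f x.
  move=> fA xA; rewrite -(dirichlet_sum fA) // mulr_sumr.
  by apply: eq_bigr => y _; rewrite mulrA.
have Ssym x y : S x y = S y x.
  rewrite /S !mulrBr !vmeas_trans (weight_sym G x y) eq_sym; congr (_ - _).
  by case: eqP => [->|]; rewrite ?mulr0.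
have formE f : (forall x, x \notin A -> f x = 0) ->
    (\sum_(x <- A) f x * (\sum_(y <- A) S x y * f y))%:E = energy G f.
  move=> fA; rewrite (energyE fA); congr (_%:E).
  by apply: eq_big_seq => x xA; rewrite SE.
have S0 f : 0 <= \sum_(x <- A) f x * (\sum_(y <- A) S x y * f y).
  (* The form only sees [f] on [A], whereas [formE] requires vanishing outside. *)
  pose g x := if x \in A then f x else 0.
  have gA x : x \notin A -> g x = 0 by rewrite /g => /negbTE ->.
  have := energy_ge0 g; rewrite -formE // lee_fin.
  have gE x : x \in A -> g x = f x by rewrite /g => ->.
  congr (_ <= _); apply: eq_big_seq => x xA; rewrite gE //; congr (_ * _).
  by apply: eq_big_seq => y yA; rewrite gE.
have [t [f [f0 fA fE th]]] :=
  rayleigh_le Ssym (fun x _ => vmeas_gt0 G x) S0 h0.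
exists t; last by rewrite -formE // lee_fin.
exists f; split=> // [x /negP/fA//|x xA].
apply: (mulfI (lt0r_neq0 (vmeas_gt0 G x))).
by rewrite -SE // fE // mulrCA.
Qed.

(** Besides the estimate itself, this gives the boundedness without which [inf] could not be
    compared with an eigenvalue. *)
Lemma lambda_lbound : lbound [set t | dirichlet_eigenvalue G [set` A] t] M^-1.
Proof.
move=> t /= et; have := eigenvalue_ge sw wM et.
have [f [[x fx] fA _]] := et.
have xA : x \in A by apply: contraNT fx => /negP /fA ->.
by have M0 := poisson_bound_gt0 xA; rewrite -div1r ler_pdivrMr.
Qed.

Lemma lambda_ge x : x \in A -> M^-1 <= dirichlet_lambda G [set` A].
Proof.
move=> xA; apply: lb_le_inf; last exact: lambda_lbound.
(* A nonzero test function, so that the set of eigenvalues is nonempty and its [inf] is not a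
   default value. *)
pose h y : R := (y == x)%:R.
have hA y : y \notin A -> h y = 0.
  by move=> yA; rewrite /h; case: eqP => // yx; rewrite yx xA in yA.
have [|t et _] := rayleigh_exists _ hA; last by exists t.
rewrite (bigD1_seq x) ?fset_uniq //= /h eqxx expr1n mulr1.
rewrite ltr_pwDl ?vmeas_gt0 // sumr_ge0 // => y _.
by rewrite mulr_ge0 ?sqr_ge0 // ltW // vmeas_gt0.
Qed.

(** [rayleigh_exists] gives an eigenvalue below the Rayleigh quotient of [h], and [dirichlet_lambda]
    is below every eigenvalue. *)
Lemma lambda_le_energy h : (forall x, x \notin A -> h x = 0) ->
  ((dirichlet_lambda G [set` A] * \sum_(x <- A) vmeas G x * h x ^+ 2)%:E
   <= energy G h)%E.
Proof.
move=> hA.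
have : 0 <= \sum_(x <- A) vmeas G x * h x ^+ 2.
  by rewrite sumr_ge0 // => x _; rewrite mulr_ge0 ?sqr_ge0 // ltW // vmeas_gt0.
rewrite le_eqVlt => /orP[/eqP <-|h0]; first by rewrite mulr0 energy_ge0.
have [t et] := rayleigh_exists h0 hA; apply: le_trans.
rewrite lee_fin ler_wpM2r ?(ltW h0) //; apply: ge_inf => //.
by exists M^-1; exact: lambda_lbound.
Qed.

End Lambda.
End Dirichlet.

(** * Mean exit times as solutions of the Poisson equation *)

Section MeanExit.
Context {R : realType} {V : countType} (G : weighted_graph R V).
Context {d : measure_display} {Om : measurableType d}.
Context (Pr : V -> probability Om R) (X : nat -> Om -> V).
Hypothesis hp0 : cond_p0 G.
Hypothesis hX : is_random_walk G Pr X.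
Implicit Types (A : {fset V}) (z : V).

Definition visits (D : nat -> set V) n : set Om :=
  [set w | forall i, (i <= n)%N -> D i (X i w)].

Lemma measurable_visits D n : measurable (visits D n).
Proof.
have -> : visits D n =
    \bigcap_(i in [set i | (i < n.+1)%N])
      \bigcup_(x in D i) [set w | X i w = x].
  apply/seteqP; split=> w h i /=; first by exists (X i w) => //; exact: h.
  by move=> ni; have [x Dx /= ->] := h i ni.
apply: bigcap_measurableType => i _.
rewrite bigcup_mkcond; apply: countable_bigcupT_measurable => [|x].
  exact: countableP.
by case: ifP => // _; exact: (proj1 hX).
Qed.

(** The probability that the positions at times 1 to [n] lie in [A]; the start [z] is unconstrained,
    so [prob_stay] adds the factor for time 0. *)
Fixpoint survival A n z : R :=
  if n is m.+1 then \sum_(a <- A) trans G z a * survival A m a else 1.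

Lemma survival_ge0 A n z : 0 <= survival A n z.
Proof.
elim: n z => //= n IH z; apply: sumr_ge0 => a _.
by rewrite mulr_ge0 ?trans_ge0.
Qed.

(* Prescribing the first positions as well lets the last conditions be expanded
   one at a time, without proving the Markov property. *)
Lemma prob_path_survival A z j m (s : nat -> V) :
  Pr z (visits (fun i => if (i <= m)%N then [set s i] else [set` A]) (m + j)) =
  ((s 0%N == z)%:R * \prod_(i < m) trans G (s i) (s i.+1)
     * survival A j (s m))%:E.
Proof.
elim: j m s => [|j IH] m s.
  rewrite mulr1 addn0 -(proj2 hX) /visits; congr (Pr z _).
  by apply/seteqP; split=> w /= h i im; have := h i im; rewrite im.
(* Split according to the position [a] at time [m.+1], and append it to the prescribed
   trajectory. *)
pose s' a i := if i == m.+1 then a else s i.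
pose D a i : set V := if (i <= m.+1)%N then [set s' a i] else [set` A].
have -> : visits (fun i => if (i <= m)%N then [set s i] else [set` A])
    (m + j.+1) = \bigcup_(a in [set` A]) visits (D a) (m.+1 + j).
  rewrite addnS -addSn; apply/seteqP; split=> [w h|w [a aA h] i ij] /=.
    exists (X m.+1 w) => [|i ij].
      by have := h m.+1 (leq_addr _ _); rewrite ltnn.
    rewrite /D /s'; have [->|im] := eqVneq i m.+1; first by rewrite leqnn.
    by rewrite leq_eqVlt (negbTE im) /= ltnS; exact: h.
  have := h i ij; rewrite /D /s'; have [->|im] := eqVneq i m.+1.
    by rewrite leqnn ltnn /= => ->.
  by rewrite leq_eqVlt (negbTE im) /= ltnS.
rewrite measure_fin_bigcup //; last 2 first.
- move=> a b _ _ [w [/= /(_ m.+1 (leq_addr _ _))]].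
  rewrite /D /s' leqnn eqxx => <- /(_ m.+1 (leq_addr _ _)).
  by rewrite leqnn eqxx.
- by move=> a _; exact: measurable_visits.
rewrite -fsbig_seq ?fset_uniq //.
rewrite (eq_bigr _ (fun a _ => IH m.+1 (s' a))).
rewrite sumEFin; congr (_%:E); rewrite [RHS]mulr_sumr.
apply: eq_bigr => a _; rewrite /s' /= eqxx big_ord_recr /= eqxx.
rewrite (ltn_eqF (ltnSn m)) !mulrA; congr (_ * _ * _ * _ * _).
apply: eq_bigr => i _.
by rewrite eqSS !ltn_eqF // ltnS ltnW.
Qed.

Lemma prob_stay A n z :
  Pr z (visits (fun=> [set` A]) n) = ((z \in A)%:R * survival A n z)%:E.
Proof.
pose D a i : set V := if (i <= 0)%N then [set a] else [set` A].
have -> : visits (fun=> [set` A]) n =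
    \bigcup_(a in [set` A]) visits (D a) n.
  apply/seteqP; split=> [w h|w [a aA h] i ij].
    exists (X 0%N w) => [|i ij]; first exact: (h 0%N).
    by rewrite /D; case: i ij => [|i] ij //; exact: h.
  by have := h i ij; rewrite /D; case: i ij => //= _ ->.
rewrite measure_fin_bigcup //; last 2 first.
- move=> a b _ _ [w [/= /(_ 0%N (leq0n _))]].
  by rewrite /D => <- /(_ 0%N (leq0n _)).
- by move=> a _; exact: measurable_visits.
rewrite -fsbig_seq ?fset_uniq //.
rewrite (eq_bigr _ (fun a _ => prob_path_survival A z n 0 (fun=> a))).
under eq_bigr do rewrite big_ord0 mulr1.
rewrite sumEFin; congr (_%:E).
have [zA|zA] := boolP (z \in A).
  rewrite (bigD1_seq z) ?fset_uniq //= eqxx big1 ?addr0 // => a /negbTE ->.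
  by rewrite mul0r.
rewrite mul0r big1_seq // => a /= aA; case: eqP => [az|]; rewrite ?mul0r //.
by rewrite -az aA in zA.
Qed.

(** The exit time counts the [n] such that the walk is still in [A] through time [n]; both sides are
    infinite if it never leaves. *)
Lemma exit_timeE A w :
  exit_time (R:=R) X [set` A] w =
  (\sum_(n <oo) (\1_(visits (fun=> [set` A]) n) w)%:E)%E.
Proof.
have ind0 n : (0 <= (\1_(visits (fun=> [set` A]) n) w : R)%:E)%E.
  by rewrite lee_fin.
have [[k0 /negP kA]|stay] := pselect (exists k, ~ (X k w \in A)); last first.
  have st k : X k w \in A by apply: contrapT => kA; apply: stay; exists k.
  have -> : exit_time (R:=R) X [set` A] w = +oo%E.
    rewrite /exit_time [X in ereal_inf X](_ : _ = set0) ?ereal_inf0 //.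
    by apply/seteqP; split=> // x [k /= /(_ (st k))].
  apply/esym/eq_infty => t.
  have := @nneseries_lim_ge _
    (fun n => (\1_(visits (fun=> [set` A]) n) w : R)%:E)
    xpredT 0%N (Num.truncn t).+1 (fun i _ _ => ind0 i).
  apply: le_trans; rewrite (eq_bigr (fun=> 1%E)); last first.
    by move=> i _; rewrite indicE mem_set //= => j _; exact: st.
  rewrite sumEFin lee_fin big_const_nat subn0 iter_addr_0.
  by rewrite ltW // truncnS_gt.
have ex : exists k, X k w \notin A by exists k0.
case: (ex_minnP ex) => k kA' kmin.
have ind n : \1_(visits (fun=> [set` A]) n) w = (n < k)%:R :> R.
  rewrite indicE; congr (nat_of_bool _)%:R; apply/idP/idP => [/set_mem h|nk].
    rewrite ltnNge; apply/negP => kn.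
    by have := h _ kn; rewrite /= (negbTE kA').
  apply/mem_set => i iN /=; apply: contraTT (leq_ltn_trans iN nk) => /kmin.
  by rewrite -leqNgt.
transitivity (k%:R%:E : \bar R).
  apply/eqP; rewrite eq_le; apply/andP; split.
    by apply: ereal_inf_lbound; exists k => //; exact/negP.
  apply: le_ereal_inf_tmp => _ [j /negP jA <-].
  by rewrite lee_fin ler_nat; exact: kmin.
rewrite (nneseries_split 0 k) //.
rewrite add0n eseries0 ?adde0; last first.
  by move=> i ki _; rewrite ind ltnNge ki.
rewrite (eq_big_nat _ _ (F2:=fun=> 1%E)); last first.
  by move=> i /andP[_ ik]; rewrite ind ik.
by rewrite sumEFin big_const_nat subn0 iter_addr_0.
Qed.

(** The tail formula: the expectation of $T_A$ is the sum of the probabilities of $T_A > n$, by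
    exchanging integral and series. *)
Lemma mean_exit_series A z :
  mean_exit Pr X z [set` A] =
  (\sum_(n <oo) ((z \in A)%:R * survival A n z)%:E)%E.
Proof.
rewrite /mean_exit; under eq_integral do rewrite exit_timeE.
rewrite integral_nneseries //.
- apply: eq_eseriesr => n _.
  rewrite integral_indic //; last exact: measurable_visits.
  by rewrite setIT; exact: prob_stay.
- move=> n; apply/measurable_EFinP; apply: measurable_indic.
  exact: measurable_visits.
Qed.

(** Iterating [w = 1 + P w] on [A] expands [w] into the survival series with a remainder between 0
    and [max w] times a survival probability. *)
Lemma mean_exitE A w z : poisson_solution G A w ->
  mean_exit Pr X z [set` A] = (w z)%:E.
Proof.
move=> sw; have [wA wl] := sw; rewrite mean_exit_series.
have [zA|zA] := boolP (z \in A); last first.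
  by rewrite wA // eseries0 // => n _ _; rewrite mul0r.
have [y yA wy] := fset_argmax w zA.
have wE x : x \in A -> w x = 1 + \sum_(a <- A) trans G x a * w a.
  move=> xA; rewrite -(wl x xA) (laplacianE (B:=A)); last first.
    by move=> u /wA ->; rewrite mulr0.
  by ring.
(* The second bound makes [w] the sum of the series, not just an upper bound:
   the terms of a convergent series tend to 0. *)
have bnd n x : x \in A -> \sum_(0 <= k < n) survival A k x <= w x <=
    \sum_(0 <= k < n) survival A k x + w y * survival A n x.
  elim: n x => [|n IH] x xA.
    by rewrite !big_geq // add0r mulr1 wy // (poisson_ge0 hp0 _ sw).
  rewrite big_nat_recl //= wE // -[X in _ && (_ <= X)]addrA !lerD2l.
  rewrite exchange_big mulr_sumr -big_split /=.
  rewrite big_seq [X in _ <= X <= _]big_seq.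
  rewrite [X in _ && (_ <= X)]big_seq.
  apply/andP; split; apply: ler_sum => a aA; have /andP[l u] := IH a aA.
    by rewrite -mulr_sumr ler_wpM2l ?trans_ge0.
  rewrite -mulr_sumr [w y * _]mulrCA -mulrDr ler_wpM2l ?trans_ge0 //.
under eq_eseriesr do rewrite mul1r.
pose u n := survival A n z.
have u0 n : 0 <= u n by exact: survival_ge0.
have cu : cvgn (series u).
  apply: nondecreasing_is_cvgn; first by apply: nondecreasing_series.
  exists (w z) => _ [n _ <-]; rewrite /series /=.
  by have /andP[] := bnd n z zA.
have lu : series u @ \oo --> w z.
  apply: (@squeeze_cvgr _ _ _ _ (fun n => w z - w y * u n) (fun=> w z)).
  - apply: nearW => n; rewrite /series /=.
    by have /andP[-> h] := bnd n z zA; rewrite andbT lerBlDr.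
  - rewrite -[X in _ --> X]subr0 -(mulr0 (w y)).
    apply: cvgB; first exact: cvg_cst.
    by apply: cvgM; [exact: cvg_cst | exact: cvg_series_cvg_0].
  - exact: cvg_cst.
apply/cvg_lim => //.
rewrite [X in X @ _ --> _](_ : _ = EFin \o series u).
  by apply: cvg_EFin => //; exact: nearW.
by apply/funext => n; rewrite /= /series /= sumEFin.
Qed.

End MeanExit.

(** * Comparison of the four quantities *)

Section Balls.
Context {R : realType} {V : countType} (G : weighted_graph R V).
Hypothesis hp0 : cond_p0 G.

Definition fball x (r : R) : {fset V} := fset_set (gball G x r).

Lemma in_fball x (r : R) y : (y \in fball x r) = ((gdist G x y)%:R < r).
Proof.
rewrite in_fset_set; last exact: gball_finite.
by apply/idP/idP => [/set_mem|?]; [|exact: mem_set].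
Qed.

Lemma set_fball x (r : R) : [set` fball x r] = gball G x r.
Proof. by rewrite fset_setK //; exact: gball_finite. Qed.

Lemma volE x (r : R) : vol G x r = (\sum_(y <- fball x r) vmeas G y)%:E.
Proof.
rewrite /vol /smeas (esum_support (B:=fball x r)) ?sumEFin ?set_fball //.
  by move=> y _; rewrite lee_fin ltW // vmeas_gt0.
by move=> y; rewrite in_fball => yr /negP.
Qed.

(** The choice is harmless: [poisson_le] with equal sets gives uniqueness. *)
Definition exit_mean (A : {fset V}) : V -> R :=
  sval (cid (poisson_exists hp0 A)).

Lemma exit_meanP A : poisson_solution G A (exit_mean A).
Proof. exact: svalP (cid (poisson_exists hp0 A)). Qed.

Lemma exit_mean_le (A B : {fset V}) z :
  (A `<=` B)%fset -> exit_mean A z <= exit_mean B z.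
Proof. move=> AB; exact: poisson_le AB (exit_meanP A) (exit_meanP B). Qed.

Lemma exit_mean_fball_le x y z (r s : R) : gball G x r `<=` gball G y s ->
  exit_mean (fball x r) z <= exit_mean (fball y s) z.
Proof.
move=> rs; apply: exit_mean_le; apply/fsubsetP => u.
by rewrite !in_fball; exact: rs.
Qed.

Definition annulus x (r s : R) : {fset V} :=
  [fset y in fball x s | y \notin fball x r]%fset.

Lemma in_annulus x (r s : R) y :
  (y \in annulus x r s) = (r <= (gdist G x y)%:R < s).
Proof. by rewrite !inE !in_fball -leNgt andbC. Qed.

Lemma annvolE x (r s : R) : r <= s ->
  annvol G x r s = (\sum_(y <- annulus x r s) vmeas G y)%:E.
Proof.
move=> rs; rewrite /annvol !volE -EFinB; congr (_%:E).
rewrite (big_fsetID _ (fun y => y \in fball x r) (fball x s)) /=.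
rewrite (_ : [fset y in fball x s | y \in fball x r]%fset = fball x r).
  by rewrite addrAC subrr add0r.
apply/fsetP => y; rewrite !inE /= !in_fball.
by apply: andb_idl => yr; exact: lt_le_trans yr rs.
Qed.

(** An edge leaving the ball of radius [r] ends at distance less than [r + 1 <= 2 * r]. *)
Lemma annvol_gt0 x (r : R) : 1 <= r ->
  0 < \sum_(y <- annulus x r (2 * r)) vmeas G y.
Proof.
move=> r1.
have x0 : x \in fball x r by rewrite in_fball gdistxx; lra.
have [y [z [yr zr yz]]] := exit_edge G x0.
have zD : z \in annulus x r (2 * r).
  rewrite !inE zr andbT in_fball; rewrite in_fball in yr.
  have : (gdist G x z <= gdist G x y + 1)%N.
    by rewrite (leq_trans (gdist_triangle G x y z)) // leq_add2l gdist_adj.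
  by rewrite -(ler_nat R) natrD; lra.
rewrite (bigD1_seq z) ?fset_uniq //= ltr_pwDl ?vmeas_gt0 // sumr_ge0 // => u _.
by rewrite ltW // vmeas_gt0.
Qed.

Lemma gdist_eq0 x y : gdist G x y = 0%N -> x = y.
Proof. by have [p [_ <- <-]] := gdist_path G x y; move=> /size0nil ->. Qed.

(* For [r < 4] the balls of radius [r / 4] are single points, so that any
   integer of [r, 2r) is suitable. *)
Lemma middle_radius x (r : R) : 1 <= r -> exists k : nat,
  r <= k%:R < 2 * r /\ forall z, gdist G x z = k ->
    (fball z (r / 4) `<=` annulus x r (2 * r))%fset.
Proof.
move=> r1; have [r4|r4] := ltP r 4.
  have ex : exists n : nat, r <= n%:R.
    by exists (Num.truncn r).+1; rewrite ltW // truncnS_gt.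
  case: (ex_minnP ex) => k rk kmin.
  have k2r : k%:R < 2 * r.
    case: k rk kmin => [|k] rk kmin; first by rewrite mulr0n; lra.
    have : k%:R < r by rewrite ltNge; apply/negP => /kmin; rewrite ltnn.
    by rewrite -[k.+1]addn1 natrD; lra.
  exists k; rewrite rk k2r; split=> // z zk; apply/fsubsetP => y.
  rewrite in_fball in_annulus => zy.
  suff <- : z = y by rewrite zk rk k2r.
  apply: gdist_eq0; apply/eqP; rewrite -leqn0 -ltnS -(ltr_nat R) mulr1n; lra.
(* Here [3r/2 < k <= 3r/2 + 1], so [k - r/4 > r], and [k + r/4 <= 7r/4 + 1 <= 2r] exactly because
   [r >= 4]. *)
exists (Num.truncn (3 * r / 2)).+1.
have := truncnS_gt (3 * r / 2).
have : (Num.truncn (3 * r / 2))%:R <= 3 * r / 2 by rewrite truncn_le; lra.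
move: (Num.truncn _) => k kle; rewrite -[k.+1]addn1 natrD => klt.
split; first by apply/andP; split; lra.
move=> z zk; apply/fsubsetP => y; rewrite in_fball in_annulus => zy.
have := gdist_triangle G x z y; have := gdist_triangle G x y z.
rewrite zk (gdistC _ y z) -!(ler_nat R) !natrD => ? ?.
by apply/andP; split; lra.
Qed.

Lemma laplacianZ f (c : R) x :
  laplacian G (fun y => c * f y) x = c * laplacian G f x.
Proof.
rewrite !laplacian_nbrs // mulrBr mulr_sumr; congr (_ - _).
by apply: eq_bigr => y _; rewrite mulrCA.
Qed.

(** Truncation at 1 is a contraction. An edge entering the region [d < k] has its outer end at
    distance exactly [k], where the truncation is already 1, so setting the inside to 1 costs
    nothing. *)
Lemma energy_cutoff (x : V) (k : nat) (f : V -> R) :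
  (forall z, gdist G x z = k -> 1 <= f z) ->
  (energy G (fun y => if (gdist G x y < k)%N then 1 else Num.min 1 (f y))%R
   <= energy G f)%E.
Proof.
move=> fk; rewrite /energy lee_wpmul2l ?lee_fin ?invr_ge0 //.
apply: le_esum => -[y z] _ /=; rewrite lee_fin.
have [yz|/weight_eq0 ->] := boolP (adj G y z); last by rewrite !mul0r.
rewrite ler_wpM2l ?weight_ge0 //.
have step u v : adj G u v -> (gdist G x u < k)%N -> (k <= gdist G x v)%N ->
    Num.min 1 (f v) = 1.
  move=> uv uk vk; apply/min_idPl/fk/eqP; rewrite eqn_leq vk andbT.
  rewrite (leq_trans (gdist_triangle G x u v)) // (leq_trans _ uk) //.
  by rewrite -addn1 leq_add2l gdist_adj.
case: ltnP => yk; case: ltnP => zk.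
- by rewrite subrr expr0n sqr_ge0.
- by rewrite (step y z) // subrr expr0n sqr_ge0.
- by rewrite (step z y) ?subrr ?expr0n ?sqr_ge0 // (adj_sym G).
- have := sqr_ge0 (f y - f z); rewrite !minElt !expr2.
  by do 2!case: ltP => ?; nra.
Qed.

End Balls.

(** * The cycle of inequalities under (TC) and (VD), in real numbers *)

Section Comparison.
Context {R : realType} {V : countType} (G : weighted_graph R V).
Hypothesis hp0 : cond_p0 G.
Variables (CT DV : R).
Hypothesis CT1 : 1 < CT.
Let E x (r : R) := exit_mean hp0 (fball G x r) x.
Hypothesis TC : forall x y (r : R), 0 < r -> gball G x r y ->
  E x (2 * r) <= CT * E y r.
Hypothesis VD : forall x (r : R), 0 < r ->
  \sum_(y <- fball G x (2 * r)) vmeas G y <=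
  DV * \sum_(y <- fball G x r) vmeas G y.

Lemma exit_mean_max x z (r : R) : 0 < r ->
  exit_mean hp0 (fball G x (2 * r)) z <= CT * E x (2 * r).
Proof.
move=> r0; have [zr|zr] := boolP (z \in fball G x (2 * r)); last first.
  have [-> // _] := exit_meanP hp0 (fball G x (2 * r)).
  apply: mulr_ge0; first exact: ltW (lt_trans ltr01 CT1).
  exact: (poisson_ge0 hp0 _ (exit_meanP hp0 _)).
rewrite in_fball // in zr.
have xz : gball G z (2 * r) x by apply: gball_sym.
apply: le_trans (TC _ xz); last by rewrite mulr_gt0.
apply: exit_mean_fball_le => //.
have -> : 2 * (2 * r) = 2 * r + 2 * r by ring.
exact: gball_sub.
Qed.

(** Enlarge the radius to [4r], move the centre to [z] by (TC), which leaves radius [2r], then halve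
    the radius three times with (TC) at the fixed centre [z]. *)
Lemma exit_mean_quarter x z (r : R) : 0 < r -> gball G x (2 * r) z ->
  E x (2 * r) <= CT ^+ 4 * E z (r / 4).
Proof.
move=> r0 xz.
have halve s : 0 < s -> E z (2 * s) <= CT * E z s.
  by move=> s0; apply: TC => //; exact: gball_center.
have h0 := @halve r r0; have h1 := @halve (r / 2); have h2 := @halve (r / 4).
have e1 : 2 * (r / 2) = r by field.
have e2 : 2 * (r / 4) = r / 2 by field.
rewrite e1 in h1; rewrite e2 in h2.
have CT0 : 0 <= CT := ltW (lt_trans ltr01 CT1).
have : E x (2 * r) <= E x (2 * (2 * r)).
  by apply: exit_mean_fball_le => //; apply: sub_gball; lra.
move=> /le_trans; apply; apply: (le_trans (TC _ xz)); first lra.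
rewrite exprS -mulrA ler_wpM2l // (le_trans h0) // exprS -mulrA ler_wpM2l //.
rewrite (le_trans (h1 _)) //; first lra.
by rewrite exprS -mulrA ler_wpM2l // (le_trans (h2 _)) ?expr1 //; lra.
Qed.

(* Test functions for the resistance: [1] for [d < k], and the truncation at
   [1] of the rescaled mean exit time of the annulus for [d >= k]. *)
Lemma annulus_test_function x (r : R) : 1 <= r -> exists f : V -> R,
  [/\ forall y, gball G x r y -> f y = 1,
      forall y, ~ gball G x (2 * r) y -> f y = 0 &
      (energy G f <= (CT ^+ 9 * (\sum_(y <- annulus G x r (2 * r)) vmeas G y)
                      / E x (2 * r))%:E)%E].
Proof.
move=> r1; have [k [/andP[rk k2r] kD]] := middle_radius hp0 x r1.
set D := annulus G x r (2 * r); set e := E x (2 * r).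
have r0 : 0 < r by lra.
have e0 : 0 < e.
  apply: lt_le_trans ltr01 _.
  apply: poisson_ge1 hp0 _ _ _ (exit_meanP hp0 _) _ => //.
  by rewrite in_fball // gdistxx; lra.
have CT0 : 0 < CT := lt_trans ltr01 CT1.
(* The scaling that makes [u >= 1] on the sphere of radius [k], by [exit_mean_quarter] and the
   inclusion of [B(z, r/4)] in the annulus. *)
pose c := CT ^+ 4 / e.
have c0 : 0 < c by rewrite divr_gt0 // exprn_gt0.
pose u y := c * exit_mean hp0 D y.
have [wD wl] := exit_meanP hp0 D.
have uk z : gdist G x z = k -> 1 <= u z.
  move=> zk; have xz : gball G x (2 * r) z by rewrite /gball /= zk.
  have h : E z (r / 4) <= exit_mean hp0 D z by apply: exit_mean_le; exact: kD.
  have := exit_mean_quarter r0 xz; rewrite -/e => h2.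
  rewrite /u /c mulrAC ler_pdivlMr // mul1r (le_trans h2) //.
  by rewrite ler_wpM2l // exprn_ge0 // ltW.
exists (fun y => if (gdist G x y < k)%N then 1 else Num.min 1 (u y)); split.
- move=> y; rewrite /gball /= => yr; rewrite ifT // -(ltr_nat R); lra.
- move=> y /negP; rewrite /gball /= -leNgt => yr.
  rewrite ifF; last by apply/negbTE; rewrite -leqNgt -(ler_nat R); lra.
  rewrite /u wD ?mulr0; first by apply/min_idPr.
  by rewrite in_annulus // negb_and -!leNgt yr orbT.
apply: le_trans (energy_cutoff uk) _.
rewrite (energyE hp0 (A:=D)); last first.
  by move=> y yD; rewrite /u wD // mulr0.
(* The exponent is 4 + 1 + 4: one [c] from each factor of the energy of [u], and [CT * e] bounding
   the exit time of the annulus. *)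
have cE s : CT ^+ 9 * s / e = c * (CT * e) * c * s.
  by rewrite /c; field; rewrite gt_eqF.
rewrite lee_fin cE mulr_sumr big_seq [leRHS]big_seq.
apply: ler_sum => y yD; rewrite laplacianZ // -mulrN wl // mulr1.
have -> : u y * (vmeas G y * c) = c * exit_mean hp0 D y * c * vmeas G y.
  by rewrite /u; ring.
have wle : exit_mean hp0 D y <= CT * e.
  apply: le_trans (exit_mean_max x y r0); apply: exit_mean_le.
  by apply/fsubsetP => v; rewrite !inE => /andP[].
rewrite ler_wpM2r ?(ltW (vmeas_gt0 _ _)) // ler_wpM2r ?(ltW c0) //.
by rewrite ler_wpM2l ?(ltW c0).
Qed.

(** Here [i] is the conductance, the infimum of energies. Below, every test function is 1 on the
    inner ball and obeys [lambda_le_energy]; above, [annulus_test_function] is a competitor. *)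
Lemma ann_resistance_bounds x (r : R) : 1 <= r -> exists i : R,
  [/\ 0 < i, ann_resistance G x r (2 * r) = (i^-1)%:E,
      ball_lambda G x (2 * r) * \sum_(y <- fball G x r) vmeas G y <= i &
      i <= CT ^+ 9 * (\sum_(y <- annulus G x r (2 * r)) vmeas G y)
           / E x (2 * r)].
Proof.
move=> r1; have r0 : 0 < r by lra.
have [f [f1 f0 fE]] := annulus_test_function x r1.
pose F := [set energy G f | f in [set f : V -> R |
  (forall y, gball G x r y -> f y = 1%R) /\
  (forall y, (~` gball G x (2 * r)) y -> f y = 0%R)]].
set s := \sum_(y <- fball G x r) vmeas G y.
have s0 : 0 < s.
  rewrite /s (bigD1_seq x) ?fset_uniq ?in_fball ?gdistxx //=.
  rewrite ltr_pwDl ?vmeas_gt0 //.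
  by apply: sumr_ge0 => y _; rewrite ltW // vmeas_gt0.
have xb : x \in fball G x (2 * r) by rewrite in_fball // gdistxx; lra.
have sw := exit_meanP hp0 (fball G x (2 * r)).
have wM z : exit_mean hp0 (fball G x (2 * r)) z <= CT * E x (2 * r).
  exact: exit_mean_max.
have l0 : 0 < ball_lambda G x (2 * r).
  rewrite /ball_lambda -set_fball //.
  apply: lt_le_trans (lambda_ge hp0 sw wM xb).
  by rewrite invr_gt0 (poisson_bound_gt0 hp0 sw wM xb).
have lb : ((ball_lambda G x (2 * r) * s)%:E <= ereal_inf F)%E.
  apply: le_ereal_inf_tmp => _ [g [g1 g0] <-].
  have gA y : y \notin fball G x (2 * r) -> g y = 0.
    by rewrite in_fball // => /negP; exact: g0.
  apply: le_trans (lambda_le_energy hp0 sw wM gA).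
  rewrite set_fball // lee_fin ler_wpM2l ?(ltW l0) //.
  rewrite (big_fsetID _ (fun y => y \in fball G x r) (fball G x (2 * r))) /=.
  rewrite (_ : [fset y in fball G x (2 * r) | y \in fball G x r]%fset
               = fball G x r); last first.
    apply/fsetP => y; rewrite !inE /= !in_fball //; apply: andb_idl; lra.
  rewrite -[s]addr0 lerD //.
    rewrite /s le_eqVlt; apply/orP; left; apply/eqP; apply: eq_big_seq => y.
    by rewrite in_fball // => /g1 ->; rewrite expr1n mulr1.
  by apply: sumr_ge0 => y _; rewrite mulr_ge0 ?sqr_ge0 // ltW // vmeas_gt0.
have ub : (ereal_inf F <= energy G f)%E by apply: ereal_inf_lbound; exists f.
have {}ub := le_trans ub fE.
rewrite /ann_resistance /resistance -/F.
(* The two bounds exclude infinite values; as [i > 0], the extended inverse is the real one. *)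
move: (ereal_inf F) lb ub => [i| |] //; rewrite !lee_fin => lb ub.
have i0 : 0 < i by apply: lt_le_trans lb; rewrite mulr_gt0.
by exists i; rewrite inver gt_eqF.
Qed.

(** [M] is the maximal mean exit time and [b] the product of resistance and volume. The last four
    bounds form a cycle from the inverse eigenvalue through [M], the exit time at [x] and [b], back
    to the inverse eigenvalue. *)
Lemma four_quantities_chain x (r : R) : 1 <= r -> exists M b : R,
  [/\ (exists2 z, gball G x (2 * r) z &
                   exit_mean hp0 (fball G x (2 * r)) z = M) /\
        (forall z, exit_mean hp0 (fball G x (2 * r)) z <= M),
      (ann_resistance G x r (2 * r) * annvol G x r (2 * r))%E = b%:E &
      [/\ 0 < E x (2 * r),
          0 < (ball_lambda G x (2 * r))^-1 <= M,
          M <= CT * E x (2 * r),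
          E x (2 * r) <= CT ^+ 9 * b &
          b <= DV * (ball_lambda G x (2 * r))^-1]].
Proof.
move=> r1; have r0 : 0 < r by lra.
have [i [i0 ri li iE]] := ann_resistance_bounds x r1.
have xb : x \in fball G x (2 * r) by rewrite in_fball // gdistxx; lra.
have sw := exit_meanP hp0 (fball G x (2 * r)).
have [z zb zM] := fset_argmax (exit_mean hp0 (fball G x (2 * r))) xb.
set M := exit_mean hp0 (fball G x (2 * r)) z in zM *.
have M0 : 0 <= M by exact: (poisson_ge0 hp0 _ sw).
have wM y : exit_mean hp0 (fball G x (2 * r)) y <= M.
  have [/zM//|yb] := boolP (y \in fball G x (2 * r)).
  by have [-> //] := sw.
have e0 : 0 < E x (2 * r) by apply: lt_le_trans ltr01 (poisson_ge1 hp0 sw xb).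
have Mp := poisson_bound_gt0 hp0 sw wM xb.
have lM : M^-1 <= ball_lambda G x (2 * r).
  by rewrite /ball_lambda -set_fball //; exact: (lambda_ge hp0 sw wM xb).
have l0 : 0 < ball_lambda G x (2 * r).
  by apply: lt_le_trans lM; rewrite invr_gt0.
set v := \sum_(y <- annulus G x r (2 * r)) vmeas G y in iE.
have v0 : 0 < v by exact: annvol_gt0.
exists M, (i^-1 * v); split.
- split=> //; exists z => //; rewrite -set_fball //.
- by rewrite ri annvolE // ?EFinM //; lra.
split=> //.
- by rewrite invr_gt0 l0 /= -[leRHS]invrK lef_pV2 // posrE invr_gt0.
- exact: exit_mean_max.
- by rewrite mulrCA [leRHS]mulrC ler_pdivlMr // mulrC -ler_pdivlMr.
set s := \sum_(y <- fball G x r) vmeas G y in li.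
(* The annulus lies in the ball of radius [2r], whose volume (VD) controls by that of the inner
   ball. *)
have vs : v <= DV * s.
  apply: le_trans (VD x r0).
  rewrite [leRHS](big_fsetID _ (fun y => y \in fball G x r)) /= lerDr.
  by apply: sumr_ge0 => y _; rewrite ltW // vmeas_gt0.
have s0 : 0 < s.
  rewrite /s (bigD1_seq x) ?fset_uniq ?in_fball ?gdistxx //=.
  rewrite ltr_pwDl ?vmeas_gt0 //.
  by apply: sumr_ge0 => y _; rewrite ltW // vmeas_gt0.
have DV0 : 0 <= DV.
  by rewrite -(pmulr_lge0 _ s0) (le_trans (ltW v0)).
rewrite mulrC ler_pdivrMr // (le_trans vs) // -mulrA ler_wpM2l //.
by rewrite ler_pdivlMl.
Qed.

End Comparison.

Theorem theorem3p1 (R : realType) (V : countType) (G : weighted_graph R V)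
    (d : measure_display) (Om : measurableType d)
    (Pr : V -> probability Om R) (X : nat -> Om -> V)
    (hX : is_random_walk G Pr X)
    (hp0 : cond_p0 G) (hVD : cond_VD G) (hTC : cond_TC G Pr X) :
  exists2 C : R, 1 < C &
    forall (x : V) (r : R), 1 <= r ->
      forall a b : \bar R,
        a \in four_quantities G Pr X x r ->
        b \in four_quantities G Pr X x r ->
        ((C^-1)%:E * a <= b)%E /\ (b <= C%:E * a)%E.
Proof.
have meanE x z r : mean_exit Pr X z (gball G x r) =
    (exit_mean hp0 (fball G x r) z)%:E.
  by rewrite -(set_fball hp0) (mean_exitE hp0 hX _ (exit_meanP hp0 _)).
have [CT CT1 TC] := hTC; have [DV0 _ VD0] := hVD.
(* Only [0 < DV0] is known; [DV >= 1] makes [K] dominate each partial product of constants. *)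
pose DV := Num.max 1 DV0.
have DV1 : 1 <= DV by rewrite le_max lexx.
have TC' x y (r : R) : 0 < r -> gball G x r y ->
    exit_mean hp0 (fball G x (2 * r)) x <= CT * exit_mean hp0 (fball G y r) y.
  by move=> r0 xy; have := TC x y r r0 xy; rewrite /ball_exit !meanE lee_fin.
have VD' x (r : R) : 0 < r -> \sum_(y <- fball G x (2 * r)) vmeas G y <=
    DV * \sum_(y <- fball G x r) vmeas G y.
  move=> r0; have := VD0 x r r0; rewrite !volE // lee_fin => /le_trans; apply.
  rewrite ler_wpM2r ?le_max ?lexx ?orbT // sumr_ge0 // => y _.
  by rewrite ltW // vmeas_gt0.
(* The product of the constants met around the cycle: [CT], [CT ^+ 9] and [DV]. *)
pose K := CT ^+ 10 * DV.
have K1 : 1 < K.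
  rewrite (@lt_le_trans _ _ (CT ^+ 10)) ?exprn_egt1 // /K ler_peMr //.
  by rewrite exprn_ge0 // (le_trans ler01 (ltW CT1)).
(* Each quantity is within a factor [K] of the inverse eigenvalue [l]; comparing two of them through
   [l] costs [K] twice. *)
exists (K ^+ 2); first by rewrite exprn_egt1.
move=> x r r1.
have [M [q [[[z zb zM] wM] qE [e0 /andP[l0 lM] Me eq ql]]]] :=
  four_quantities_chain CT1 TC' VD' x r1.
set e := exit_mean _ _ _ in e0 Me eq.
set l := _^-1 in l0 lM ql.
have quantities : four_quantities G Pr X x r = [:: l%:E; e%:E; M%:E; q%:E].
  rewrite /four_quantities qE /ball_exit meanE; congr [:: _; _; _; _].
  apply/eqP; rewrite eq_le; apply/andP; split.
    by apply: ge_ereal_sup => _ [y _ <-]; rewrite meanE lee_fin.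
  by apply: ereal_sup_ubound; exists z => //; rewrite meanE zM.
have CTn n : 1 <= CT ^+ n by rewrite exprn_ege1 // ltW.
have eM : e <= M by exact: wM.
have q0 : 0 < q.
  by rewrite -(pmulr_rgt0 _ (lt_le_trans ltr01 (CTn 9))) (lt_le_trans e0).
have CTK : CT <= K.
  rewrite /K exprS -mulrA ler_peMr ?(le_trans ler01 (ltW CT1)) //.
  by rewrite mulr_ege1.
have DVK : DV <= K by rewrite /K ler_peMl // (le_trans ler01).
have CT10K : CT ^+ 10 <= K by rewrite /K ler_peMr // (le_trans ler01).
have Mq : M <= CT ^+ 10 * q.
  rewrite (le_trans Me) // exprS -mulrA ler_wpM2l //.
  exact: le_trans ler01 (ltW CT1).
have MK : M <= K * l.
  by rewrite (le_trans Mq) // /K -mulrA ler_wpM2l // (le_trans ler01).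
have K0 : 0 < K by apply: lt_trans K1.
have bounds a : a \in four_quantities G Pr X x r ->
    exists2 s : R, a = s%:E & l <= K * s /\ s <= K * l.
  rewrite quantities !inE => /or4P[] /eqP ->.
  - by exists l => //; rewrite ler_peMl ?ltW.
  - exists e => //; split; last exact: le_trans MK.
    by rewrite (le_trans lM) // (le_trans Me) // ler_wpM2r // ltW.
  - exists M => //; split=> //.
    by rewrite (le_trans lM) // ler_peMl ?ltW // (lt_le_trans l0).
  - exists q => //; split.
      by rewrite (le_trans lM) // (le_trans Mq) // ler_wpM2r // ltW.
    by rewrite (le_trans ql) // ler_wpM2r // ltW.
move=> _ _ /bounds[a -> [la al]] /bounds[b -> [lb bl]].
have le2 s t : l <= K * s -> t <= K * l -> t <= K ^+ 2 * s.
  by move=> ls tl; rewrite expr2 -mulrA (le_trans tl) // ler_wpM2l // ltW.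
rewrite -!EFinM !lee_fin; split; last exact: le2.
by rewrite ler_pdivrMl ?exprn_gt0 // le2.
Qed.
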